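(* Let $R$ be a commutative ring with identity and let $N$ be a proper submodule of an $R$-module $M$. Then the following conditions are equivalent: (a) $N$ is a strongly 2-irreducible submodule of $M$; (b) for all elements $x,y,z$ of $M$, $(Rx+Ry)\cap(Rx+Rz)\cap(Ry+Rz)\subseteq N$ implies that either $(Rx+Ry)\cap(Rx+Rz)\subseteq N$ or $(Rx+Ry)\cap(Ry+Rz)\subseteq N$ or $(Rx+Rz)\cap(Ry+Rz)\subseteq N$.
   Context: A proper submodule $N$ of $M$ is strongly 2-irreducible if whenever $H_1\cap H_2\cap H_3\subseteq N$ for submodules $H_1,H_2,H_3$ of $M$, then $H_1\cap H_2\subseteq N$ or $H_2\cap H_3\subseteq N$ or $H_1\cap H_3\subseteq N$. *)

(* Defs.v *)
From HB Require Import structures.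
From mathcomp Require Import all_boot all_algebra.
From mathcomp Require Import boolp classical_sets.

Set Implicit Arguments.
Unset Strict Implicit.
Unset Printing Implicit Defensive.

Import GRing.Theory.
Local Open Scope ring_scope.
Local Open Scope classical_set_scope.

(* Submodules are arbitrary (not necessarily decidable) subsets [H : set M];
   the boolean membership that [submod_closed] expects is the classical one,
   [in_setE : (x \in H) = H x :> Prop]. *)
Definition submodule (R : comPzRingType) (M : lmodType R) (H : set M) : Prop :=
  submod_closed (mem H).

Definition proper_submodule (R : comPzRingType) (M : lmodType R)
    (N : set M) : Prop :=
  submodule N /\ N `<` [set: M].

Definition cyclic_submodule (R : comPzRingType) (M : lmodType R)
    (x : M) : set M :=
  [set a *: x | a in [set: R]].

Definition submodule_sum (R : comPzRingType) (M : lmodType R)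
    (A B : set M) : set M :=
  [set u + v | u in A & v in B].

(* [span2 x y] is $Rx + Ry$. *)
Definition span2 (R : comPzRingType) (M : lmodType R) (x y : M) : set M :=
  submodule_sum (cyclic_submodule x) (cyclic_submodule y).

Definition strongly_2_irreducible (R : comPzRingType) (M : lmodType R)
    (N : set M) : Prop :=
  proper_submodule N /\
  forall H1 H2 H3 : set M,
    submodule H1 -> submodule H2 -> submodule H3 ->
    H1 `&` H2 `&` H3 `<=` N ->
    [\/ H1 `&` H2 `<=` N, H2 `&` H3 `<=` N | H1 `&` H3 `<=` N].

(* Main.v *)
(** For the nontrivial direction, if none of the pairwise intersections of
    [H1], [H2], [H3] lies in [N], choose [x] in [H1 `&` H2], [y] in [H2 `&` H3]
    and [z] in [H1 `&` H3], all outside [N]. Then [Rx + Rz], [Rx + Ry] and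
    [Ry + Rz] are contained in [H1], [H2] and [H3] respectively, so their
    intersection lies in [N]; but each pairwise intersection contains one of
    [x], [y], [z], contradicting the condition on elements. *)
Require Import Defs.
From mathcomp Require Import all_boot all_algebra.
From mathcomp Require Import boolp classical_sets.

Import GRing.Theory.
Local Open Scope ring_scope.
Local Open Scope classical_set_scope.

(** Trades the boolean membership inside [submod_closed] for plain application of [H], so that
    witnesses can be destructured directly. *)
Lemma submoduleP (R : comPzRingType) (M : lmodType R) (H : set M) :
  submodule H <->
  H 0 /\ forall (a : R) (u v : M), H u -> H v -> H (a *: u + v).
Proof.
split=> [[H0 HD]|[H0 HD]].
  split=> [|a u v Hu Hv]; first by move: H0; rewrite in_setE.
  by have := HD a u v; rewrite !in_setE; apply.
by split=> [|a u v]; rewrite !in_setE //; apply: HD.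
Qed.

Lemma span2_submodule (R : comPzRingType) (M : lmodType R) (x y : M) :
  submodule (span2 x y).
Proof.
apply/submoduleP; split.
  exists 0; first by exists 0 => //; rewrite scale0r.
  by exists 0; [exists 0 => //; rewrite scale0r|rewrite addr0].
move=> a _ _ [_ [b _ <-] [_ [c _ <-] <-]] [_ [d _ <-] [_ [e _ <-] <-]].
(* Coefficients of [x] and [y] collected from [a *: (b *: x + c *: y) + (d *: x + e *: y)]. *)
exists ((a * b + d) *: x); first by exists (a * b + d).
exists ((a * c + e) *: y); first by exists (a * c + e).
by rewrite !scalerDl scalerDr !scalerA addrACA.
Qed.

Lemma span2_l (R : comPzRingType) (M : lmodType R) (x y : M) : span2 x y x.
Proof.
exists x; first by exists 1 => //; rewrite scale1r.
by exists 0; [exists 0 => //; rewrite scale0r|rewrite addr0].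
Qed.

Lemma span2_r (R : comPzRingType) (M : lmodType R) (x y : M) : span2 x y y.
Proof.
exists 0; first by exists 0 => //; rewrite scale0r.
by exists y; [exists 1 => //; rewrite scale1r|rewrite add0r].
Qed.

Lemma span2_sub (R : comPzRingType) (M : lmodType R) (H : set M) (x y : M) :
  submodule H -> H x -> H y -> span2 x y `<=` H.
Proof.
move=> /submoduleP[H0 HD] Hx Hy _ [_ [a _ <-] [_ [b _ <-] <-]].
(* Appending [0] gives [b *: y] the shape [a *: u + v], so [HD] applies a second time. *)
by apply: (HD) => //; rewrite -[b *: y]addr0; apply: HD.
Qed.

Theorem theorem2p7 (R : comPzRingType) (M : lmodType R) (N : set M)
    (hN : proper_submodule N) :
  strongly_2_irreducible N <->
  (forall x y z : M,
     span2 x y `&` span2 x z `&` span2 y z `<=` N ->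
     [\/ span2 x y `&` span2 x z `<=` N,
         span2 x y `&` span2 y z `<=` N
       | span2 x z `&` span2 y z `<=` N]).
Proof.
split=> [[_ irrN] x y z sN|elN].
  have [] := irrN (span2 x y) (span2 x z) (span2 y z) => //;
    try exact: span2_submodule.
  (* The last two cases swap because the definition lists the pair (2,3) before (1,3). *)
  - by constructor 1.
  - by constructor 3.
  - by constructor 2.
split=> // H1 H2 H3 sub1 sub2 sub3 sN; apply: contrapT => notN.
(* Each inclusion would be a disjunct refuted by [notN]; its failure yields a point outside [N]. *)
have [x [[H1x H2x] Nx]] : (H1 `&` H2) `&` ~` N !=set0.
  by apply: nonsubset => ?; apply: notN; constructor 1.
have [y [[H2y H3y] Ny]] : (H2 `&` H3) `&` ~` N !=set0.
  by apply: nonsubset => ?; apply: notN; constructor 2.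
have [z [[H1z H3z] Nz]] : (H1 `&` H3) `&` ~` N !=set0.
  by apply: nonsubset => ?; apply: notN; constructor 3.
have spanN : span2 x y `&` span2 x z `&` span2 y z `<=` N.
  move=> t [[xyt xzt] yzt]; apply: sN; split; first split.
  - exact: (span2_sub _ _ _ _ _ sub1 H1x H1z).
  - exact: (span2_sub _ _ _ _ _ sub2 H2x H2y).
  - exact: (span2_sub _ _ _ _ _ sub3 H3y H3z).
(* In each case the generator shared by the two spans is forced into [N]. *)
have [sx|sy|sz] := elN x y z spanN.
- by apply: Nx; apply: sx; split; apply: span2_l.
- by apply: Ny; apply: sy; split; [apply: span2_r|apply: span2_l].
- by apply: Nz; apply: sz; split; apply: span2_r.
Qed.
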